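(* Let $0<\xi<1$. Let $(a_n)_{n\ge1}$ be a real sequence with $0<a_1<a_2<\cdots$ and $a_n\to\infty$, and let $(c_k)_{k\ge1}$, $(\gamma_k)_{k\ge1}$ be real sequences with $c_k>0$, $0<\gamma_k<\gamma_{k+1}$ for all $k$, $\gamma_k\to+\infty$, and $\sum_{k=1}^\infty c_k/\gamma_k<1$. Suppose that $$\sum_{k=1}^{\infty}c_k<+\infty\qquad\text{and}\qquad \sup_{k}\{\gamma_k(\gamma_{k+1}-\gamma_k)\}=+\infty .$$ For $n\in\mathbb N$ let $$\ell_n(\zeta)=\zeta^2+a_n^2\left(1-\frac1{a_n^{2(1-\xi)}}\sum_{k=1}^\infty\frac{c_k}{\zeta+\gamma_k}\right),\qquad f_n(\zeta)=1-\frac1{a_n^{2(1-\xi)}}\sum_{k=1}^\infty\frac{c_k}{\zeta+\gamma_k}.$$ Then the zeros of the meromorphic function $\ell_n$ form a countable set of real zeros $\{\mu_{n,k}\}_{k=1}^\infty$ together with a pair of complex-conjugate zeros $\mu_n^{\pm}$, $\mu_n^+=\overline{\mu_n^-}$, with the following properties. (1) The real zeros satisfy $$-\gamma_k<\mu_{n,k}<x_{n,k}<-\gamma_{k-1},\qquad k\in\mathbb N,$$ where $x_{n,k}$ $(k\in\mathbb N)$ are the real zeros of $f_n$ and $\gamma_0:=0$. Moreover, $$\mu_{n,k}=x_{n,k}+O\left(\frac1{a_n^{2(1-\xi)}}\right),\quad k\in\mathbb N,\quad a_n\to\infty,\qquad \lim_{n\to\infty}\mu_{n,k}=\lim_{n\to\infty}x_{n,k}=-\gamma_k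 .$$ (2) As $a_n\to\infty$, the complex-conjugate zeros admit the asymptotic representations $$\mu_n^{\pm}=-\frac12\frac1{a_n^{2(1-\xi)}}\sum_{j=1}^\infty c_j+O\left(\frac1{a_n^{2(1-\xi)}}\right)\pm i\left(a_n+O\left(\frac1{a_n^{1-2\xi}}\right)\right)\quad\text{if }0<\xi<\tfrac12,$$ $$\mu_n^{\pm}=-\frac12\frac1{a_n^{2(1-\xi)}}\sum_{j=1}^\infty c_j+O\left(\frac1{a_n^{2(1-\xi)}}\right)\pm i\left(a_n+O\left(a_n^{1-2\xi}\right)\right)\quad\text{if }\tfrac12<\xi<1,$$ $$\mu_n^{\pm}=-\frac12\frac1{a_n}\sum_{j=1}^\infty c_j+O\left(\frac1{a_n}\right)\pm i\left(a_n+O(1)\right)\quad\text{if }\xi=\tfrac12.$$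
   Context: The numbers $a_n$ are the eigenvalues of a self-adjoint positive operator $A$ with compact inverse in a separable Hilbert space $H$. The function $\ell_n$ is the restriction to the $n$-th eigenvector of $A$ of the operator-valued function $L(\zeta)=\zeta^2I+A^2-A^{2\xi}\widehat K(\zeta)$, where $I$ is the identity operator in $H$ and $\widehat K(\zeta)=\sum_{k=1}^\infty \frac{c_k}{\zeta+\gamma_k}$ is the Laplace transform of $K(t)=\sum_{k=1}^\infty c_k e^{-\gamma_k t}$. The functions $\ell_n$ and $f_n$ are meromorphic on $\mathbb C$ with poles at the points $-\gamma_k$. The parameter $\xi$ and the sequences $(c_k)$, $(\gamma_k)$ are fixed, and the $O$-estimates are for $n\to\infty$.
   Formalization: The zero-set description with the conjugate pair is for all large n, and the inequalities in (1) are for n with Σc_k/γ_k < a_n^{2(1-ξ)}, as both fail for some small n; the O-term outside the bracket in (2) is complex-valued (the separate real/imaginary reading fails for some ξ>3/4). *)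

(* Defs.v *)
From Stdlib Require Import Reals.
From Coquelicot Require Import Coquelicot.
Open Scope R_scope.

(** All sequences are indexed from 0: [a n], [c k], [gam k] stand for
    a_{n+1}, c_{k+1}, gamma_{k+1}.  Stdlib reals and
    Coquelicot complex numbers are used throughout. *)

Definition CSeries (u : nat -> C) : C :=
  (Series (fun k => Re (u k)), Series (fun k => Im (u k))).

Definition Khat (c gam : nat -> R) (z : C) : C :=
  CSeries (fun k => (RtoC (c k) / (z + RtoC (gam k)))%C).

Definition f_fun (xi : R) (a c gam : nat -> R) (n : nat) (z : C) : C :=
  (1 - RtoC (/ Rpower (a n) (2 * (1 - xi))) * Khat c gam z)%C.

Definition ell (xi : R) (a c gam : nat -> R) (n : nat) (z : C) : C :=
  (Cpow z 2 + RtoC (a n ^ 2) *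
    (1 - RtoC (/ Rpower (a n) (2 * (1 - xi))) * Khat c gam z))%C.

(** Zero of a meromorphic function with poles at the points -gam k.  The poles
    have to be excluded explicitly, since division in [C] is total and the
    value of [f_fun] and [ell] there is meaningless. *)
Definition mero_zero (gam : nat -> R) (g : C -> C) (z : C) : Prop :=
  (forall k : nat, z <> RtoC (- gam k)) /\ g z = RtoC 0.

(** gamma_{k-1}, with the convention gamma_0 = 0. *)
Definition gam_prev (gam : nat -> R) (k : nat) : R :=
  match k with
  | O => 0
  | S j => gam j
  end.

(** u_n = O(v_n) as n -> oo. *)
Definition bigO (u v : nat -> R) : Prop :=
  exists M : R, eventually (fun n => Rabs (u n) <= M * Rabs (v n)).

(** mup_n = main_n + O(e1_n) + i (a_n + O(e2_n)) and
    mum_n = main_n + O(e1_n) - i (a_n + O(e2_n)).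
    The O-term inside the bracket is real and common to both signs; the O-term
    outside the bracket is complex-valued.  Whenever e1_n = O(e2_n) this is the
    same as estimating real and imaginary parts separately. *)
Definition pair_asymptotics
    (a : nat -> R) (mup mum : nat -> C) (main e1 e2 : nat -> R) : Prop :=
  exists (Ep Em : nat -> C) (F : nat -> R),
    bigO (fun n => Cmod (Ep n)) e1 /\
    bigO (fun n => Cmod (Em n)) e1 /\
    bigO F e2 /\
    forall n : nat,
      mup n = (RtoC (main n) + Ep n + Ci * RtoC (a n + F n))%C /\
      mum n = (RtoC (main n) + Em n - Ci * RtoC (a n + F n))%C.

(* Main.v *)
Require Import Defs.
From Stdlib Require Import Reals Ranalysis5 IndefiniteDescription Lra Lia.
From Coquelicot Require Import Coquelicot.
Open Scope R_scope.

(** Write [q = a_n^(-2(1-xi))], [A = a_n^2] and [d_k = q c_k], so that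
    [f_n = 1 - sum d_k/(z + gam_k)] and [ell_n = z^2 + A f_n].

    Functions of the shape [1 - sum d_k/(z + gam_k)] with [d_k > 0] are easy to
    understand ([one_minus_Khat_zeros]): the imaginary part of the sum never
    vanishes off the real axis, and along each real interval between poles the
    sum strictly decreases, starting from +oo.  So the zeros are real, and when
    [sum d_k/gam_k < 1] there is exactly one of them in each gap
    [(-gam_k, -gam_(k-1))] ([Kreal_one_in_gap]).

    The central step reduces [ell_n] to the same shape, with no counting of
    zeros by contour integrals.  If [z0] is a nonreal zero of [ell_n], then so
    is its conjugate, and dividing both out of the partial fraction expansion
    leaves
      [ell_n z = (z - z0) (z - conj z0) (1 - sum e_k/(z + gam_k))],
      [e_k = A d_k / |z0 + gam_k|^2 > 0]
    ([factor_nonreal_zero]).  Hence all other zeros of [ell_n] are real, one in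
    each gap ([quadratic_zeros]), as soon as a single nonreal zero is known.

    That zero lies near [i a_n] and is the fixed point of
      [z |-> i a_n + A K(z) / (z + i a_n)],   [K(z) = sum d_k/(z + gam_k)],
    which for large [n] is a contraction of the unit disc about [i a_n] because
    there [|K| = O(q/a_n)] and [|z + i a_n| >= a_n]
    ([quadratic_nonreal_zero]).  The same bounds give
    [|z0 - i a_n| = O(q)].  As the stated main term [-(q/2) sum c_j] is itself
    [O(q)], this estimate gives all three asymptotic formulas, with the error
    put in the complex remainder and none in the bracket with [a_n].

    For the real zeros, [ell_n = x^2 > 0] at the zero [x] of [f_n] in the gap,
    while [ell_n] tends to -oo at [-gam_k] from the right; this gives
    [-gam_k < mu < x].  At [x], the terms with [j < k] are negative and the
    others have denominators at least [x + gam_k], so that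
    [1 = sum d_j/(x + gam_j) <= q (sum c_j) / (x + gam_k)].  Thus
    [x + gam_k <= q sum c_j] uniformly in [k] ([Kreal_le_dist]), which bounds
    [x - mu] and yields the limits. *)

(** * Series of real and complex numbers *)

Definition is_CSeries (u : nat -> C) (s : C) : Prop :=
  is_series (fun k => Re (u k)) (Re s) /\ is_series (fun k => Im (u k)) (Im s).

Lemma is_CSeries_unique (u : nat -> C) (s : C) : is_CSeries u s -> CSeries u = s.
Proof.
intros [H1 H2]; unfold CSeries.
rewrite (is_series_unique _ _ H1), (is_series_unique _ _ H2).
now destruct s.
Qed.

Lemma is_CSeries_ext (u v : nat -> C) (s : C) :
  (forall k, u k = v k) -> is_CSeries u s -> is_CSeries v s.
Proof.
intros E [H1 H2]; split; [revert H1 | revert H2];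
  apply is_series_ext; intros k; now rewrite E.
Qed.

Lemma is_CSeries_plus (u v : nat -> C) (s t : C) :
  is_CSeries u s -> is_CSeries v t -> is_CSeries (fun k => u k + v k)%C (s + t)%C.
Proof.
intros [H1 H2] [K1 K2]; split.
- exact (is_series_plus _ _ _ _ H1 K1).
- exact (is_series_plus _ _ _ _ H2 K2).
Qed.

Lemma is_CSeries_scal (w : C) (u : nat -> C) (s : C) :
  is_CSeries u s -> is_CSeries (fun k => w * u k)%C (w * s)%C.
Proof.
intros [H1 H2]; split.
- refine (is_series_minus _ _ _ _ (is_series_scal (Re w) _ _ H1)
            (is_series_scal (Im w) _ _ H2)).
- refine (is_series_plus _ _ _ _ (is_series_scal (Re w) _ _ H2)
            (is_series_scal (Im w) _ _ H1)).
Qed.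

Lemma is_CSeries_conj (u : nat -> C) (s : C) :
  is_CSeries u s -> is_CSeries (fun k => Cconj (u k)) (Cconj s).
Proof. intros [H1 H2]; split; [exact H1 | exact (is_series_opp _ _ H2)]. Qed.

Lemma ex_series_zero : ex_series (fun _ : nat => 0) /\ Series (fun _ : nat => 0) = 0.
Proof.
assert (H : is_series (fun _ : nat => 0) 0).
{ change (is_lim_seq (sum_n (fun _ : nat => 0)) 0).
  apply (is_lim_seq_ext (fun _ => 0)); [|apply is_lim_seq_const].
  intros n; rewrite sum_n_const; ring. }
split; [exists 0; exact H | now apply is_series_unique].
Qed.

Lemma Series_ge_0 (u : nat -> R) : (forall k, 0 <= u k) -> ex_series u -> 0 <= Series u.
Proof.
intros H E; destruct ex_series_zero as [_ Z]; rewrite <- Z at 1.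
apply Series_le; [|exact E]; intros k; split; [apply Rle_refl | apply H].
Qed.

Lemma Series_ge_term (u : nat -> R) (j : nat) :
  (forall k, 0 <= u k) -> ex_series u -> u j <= Series u.
Proof.
revert u; induction j as [|j IH]; intros u H E;
  assert (E' : ex_series (fun k => u (S k))) by exact (proj1 (ex_series_incr_1 u) E);
  rewrite (Series_incr_1 u E).
- generalize (Series_ge_0 (fun k => u (S k)) (fun k => H (S k)) E'); lra.
- generalize (IH (fun k => u (S k)) (fun k => H (S k)) E') (H 0%nat); simpl; lra.
Qed.

Lemma Series_gt_0 (u : nat -> R) : (forall k, 0 < u k) -> ex_series u -> 0 < Series u.
Proof.
intros H E; apply Rlt_le_trans with (1 := H 0%nat).
apply Series_ge_term; [intros k; left; apply H | exact E].
Qed.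

Lemma Rabs_Series_le (u b : nat -> R) :
  (forall k, Rabs (u k) <= b k) -> ex_series b ->
  ex_series u /\ Rabs (Series u) <= Series b.
Proof.
intros H Hb.
assert (Ha : ex_series (fun k => Rabs (u k))).
{ apply (ex_series_le (K := R_AbsRing) (V := R_CompleteNormedModule) _ b); [|exact Hb].
  intros k; unfold norm; simpl; unfold abs; simpl.
  now rewrite Rabs_Rabsolu. }
split; [now apply ex_series_Rabs|].
apply Rle_trans with (1 := Series_Rabs _ Ha).
apply Series_le; [|exact Hb].
intros k; split; [apply Rabs_pos | apply H].
Qed.

Lemma Cmod_le_abs (z : C) : Cmod z <= Rabs (Re z) + Rabs (Im z).
Proof.
rewrite <- (Rabs_pos_eq (Rabs (Re z) + Rabs (Im z))).
2: { generalize (Rabs_pos (Re z)) (Rabs_pos (Im z)); lra. }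
unfold Cmod; rewrite <- sqrt_Rsqr_abs; apply sqrt_le_1_alt.
unfold Rsqr, Re, Im.
generalize (Rabs_pos (fst z)) (Rabs_pos (snd z)); intros h1 h2.
rewrite <- (pow2_abs (fst z)), <- (pow2_abs (snd z)); nra.
Qed.

Lemma Cmult_integral (u v : C) : (u * v)%C = RtoC 0 -> u = RtoC 0 \/ v = RtoC 0.
Proof.
intros H; apply (f_equal Cmod) in H; rewrite Cmod_mult, Cmod_0 in H.
apply Rmult_integral in H; destruct H as [H|H]; [left|right]; now apply Cmod_eq_0.
Qed.

Lemma im_le_Cmod (z : C) : Rabs (Im z) <= Cmod z.
Proof. exact (Rle_trans _ _ _ (Rmax_r _ _) (Rmax_Cmod z)). Qed.

(** The factor 2 comes from bounding the real and imaginary parts separately. *)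
Lemma CSeries_dominated (u : nat -> C) (b : nat -> R) :
  (forall k, Cmod (u k) <= b k) -> ex_series b ->
  is_CSeries u (CSeries u) /\ Cmod (CSeries u) <= 2 * Series b.
Proof.
intros H Hb.
destruct (Rabs_Series_le (fun k => Re (u k)) b) as [E1 B1];
  [intros k; exact (Rle_trans _ _ _ (re_le_Cmod _) (H k)) | exact Hb |].
destruct (Rabs_Series_le (fun k => Im (u k)) b) as [E2 B2];
  [intros k; exact (Rle_trans _ _ _ (im_le_Cmod _) (H k)) | exact Hb |].
split.
- split; now apply Series_correct.
- apply Rle_trans with (1 := Cmod_le_abs _); unfold CSeries; simpl; lra.
Qed.

(** * Sums of simple fractions *)

Definition off_poles (gam : nat -> R) (z : C) : Prop :=
  forall k : nat, z <> RtoC (- gam k).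

Definition pole_seq (gam : nat -> R) : Prop :=
  0 < gam 0%nat /\ (forall k, gam k < gam (S k)) /\ is_lim_seq gam p_infty.

Definition weights (d : nat -> R) : Prop := (forall k, 0 < d k) /\ ex_series d.

Lemma off_poles_neq (gam : nat -> R) (z : C) (k : nat) :
  off_poles gam z -> (z + RtoC (gam k))%C <> RtoC 0.
Proof.
intros H E; apply (H k).
rewrite RtoC_opp.
replace z with (z + RtoC (gam k) - RtoC (gam k))%C by ring.
rewrite E; ring.
Qed.

Lemma off_poles_im (gam : nat -> R) (z : C) : Im z <> 0 -> off_poles gam z.
Proof. intros H k E; apply H; rewrite E; reflexivity. Qed.

Lemma finite_lower_bound (u : nat -> R) (N : nat) :
  (forall k, 0 < u k) -> exists m, 0 < m /\ forall k, (k < N)%nat -> m <= u k.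
Proof.
intros H; induction N as [|N [m [Hm IH]]].
- exists 1; split; [lra|]; intros k Hk; lia.
- exists (Rmin m (u N)); split; [now apply Rmin_glb_lt|].
  intros k Hk; destruct (Nat.eq_dec k N) as [->|Hn]; [apply Rmin_r|].
  apply Rle_trans with (1 := Rmin_l _ _), IH; lia.
Qed.

(** Since [gam] tends to infinity the poles do not accumulate, so a point that
    is not a pole has positive distance to all of them. *)
Lemma pole_distance (gam : nat -> R) (z : C) :
  pole_seq gam -> off_poles gam z ->
  exists m, 0 < m /\ forall k, m <= Cmod (z + RtoC (gam k)).
Proof.
intros [_ [_ Hl]] Hz.
apply is_lim_seq_spec in Hl.
destruct (Hl (1 - Re z)) as [N HN].
destruct (finite_lower_bound (fun k => Cmod (z + RtoC (gam k))) N) as [m [Hm HB]].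
{ intros k; apply Cmod_gt_0, off_poles_neq, Hz. }
exists (Rmin m 1); split; [apply Rmin_glb_lt; lra|].
intros k; destruct (Nat.lt_ge_cases k N) as [Hk|Hk].
- exact (Rle_trans _ _ _ (Rmin_l _ _) (HB k Hk)).
- apply Rle_trans with (1 := Rmin_r _ _).
  apply Rle_trans with (2 := re_le_Cmod _).
  apply Rle_trans with (2 := Rle_abs _).
  specialize (HN k Hk); destruct z; simpl in *; lra.
Qed.

Lemma Cmod_frac_le (d m : R) (w : C) :
  0 < d -> 0 < m -> m <= Cmod w -> Cmod (RtoC d / w) <= d / m.
Proof.
intros Hd Hm H.
rewrite Cmod_div by (apply Cmod_gt_0; lra).
rewrite Cmod_R, Rabs_pos_eq by lra.
apply Rmult_le_compat_l; [lra|]; now apply Rinv_le_contravar.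
Qed.

(** The point of the explicit [m] is uniformity: in the upper half plane one
    may take the imaginary part, whatever the poles are. *)
Lemma Khat_bound (d gam : nat -> R) (z : C) (m : R) :
  weights d -> 0 < m -> (forall k, m <= Cmod (z + RtoC (gam k))) ->
  is_CSeries (fun k => RtoC (d k) / (z + RtoC (gam k)))%C (Khat d gam z) /\
  Cmod (Khat d gam z) <= 2 * (Series d / m).
Proof.
intros [Hd Sd] Hm H.
destruct (CSeries_dominated (fun k => RtoC (d k) / (z + RtoC (gam k)))%C
            (fun k => d k * / m)) as [H1 H2].
- intros k; now apply Cmod_frac_le.
- now apply ex_series_scal_r.
- split; [exact H1|]; now rewrite Series_scal_r in H2.
Qed.

Lemma Khat_correct (d gam : nat -> R) (z : C) :
  pole_seq gam -> weights d -> off_poles gam z ->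
  is_CSeries (fun k => RtoC (d k) / (z + RtoC (gam k)))%C (Khat d gam z).
Proof.
intros Hg Hd Hz.
destruct (pole_distance gam z Hg Hz) as [m [Hm H]].
now apply (Khat_bound d gam z m).
Qed.

Lemma Khat_conj (d gam : nat -> R) (z : C) :
  pole_seq gam -> weights d -> off_poles gam z -> Khat d gam (Cconj z) = Cconj (Khat d gam z).
Proof.
intros Hg Hd Hz.
apply is_CSeries_unique.
apply (is_CSeries_ext (fun k => Cconj (RtoC (d k) / (z + RtoC (gam k))))%C).
- intros k; rewrite Cdiv_conj by now apply off_poles_neq.
  rewrite Cplus_conj; f_equal; [|f_equal];
    unfold Cconj, RtoC; simpl; now rewrite Ropp_0.
- now apply is_CSeries_conj, Khat_correct.
Qed.

Lemma Khat_scal (q : R) (d gam : nat -> R) (z : C) :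
  pole_seq gam -> weights d -> off_poles gam z ->
  Khat (fun k => q * d k) gam z = (RtoC q * Khat d gam z)%C.
Proof.
intros Hg Hd Hz; apply is_CSeries_unique.
apply (is_CSeries_ext (fun k => RtoC q * (RtoC (d k) / (z + RtoC (gam k))))%C).
- intros k; rewrite RtoC_mult; unfold Cdiv; ring.
- now apply is_CSeries_scal, Khat_correct.
Qed.

Lemma weights_scal (q : R) (d : nat -> R) :
  0 < q -> weights d -> weights (fun k => q * d k).
Proof.
intros Hq [H1 H2]; split.
- intros k; now apply Rmult_lt_0_compat.
- exact (ex_series_scal_l q d H2).
Qed.

(** * The sum of simple fractions on the real axis *)

Definition Kreal (d gam : nat -> R) (t : R) : R := Series (fun k => d k / (t + gam k)).

Definition off_poles_real (gam : nat -> R) (t : R) : Prop := forall k : nat, t + gam k <> 0.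

Lemma off_poles_RtoC (gam : nat -> R) (t : R) :
  off_poles gam (RtoC t) <-> off_poles_real gam t.
Proof.
split; intros H k E; apply (H k).
- apply f_equal; lra.
- apply RtoC_inj in E; lra.
Qed.

Lemma Kreal_correct (d gam : nat -> R) (t : R) :
  pole_seq gam -> weights d -> off_poles_real gam t ->
  ex_series (fun k => d k / (t + gam k)) /\
  Khat d gam (RtoC t) = RtoC (Kreal d gam t).
Proof.
intros Hg Hd Ht.
assert (H := Khat_correct d gam (RtoC t) Hg Hd (proj2 (off_poles_RtoC gam t) Ht)).
apply (is_CSeries_ext _ (fun k => RtoC (d k / (t + gam k)))) in H.
2: { intros k; now rewrite <- RtoC_plus, <- RtoC_div by apply Ht. }
destruct H as [H1 H2].
split; [eexists; exact H1|].
assert (Z : Im (Khat d gam (RtoC t)) = 0).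
{ apply (is_series_unique) in H2; rewrite <- H2.
  now rewrite (Series_ext _ (fun k => 0 * 0)), Series_scal_l, Rmult_0_l
    by (intros; simpl; ring). }
apply is_series_unique in H1.
destruct (Khat d gam (RtoC t)) as [r i]; simpl in Z, H1; rewrite Z, <- H1.
reflexivity.
Qed.

Lemma Kreal_diff (d gam : nat -> R) (s t : R) :
  pole_seq gam -> weights d -> off_poles_real gam s -> off_poles_real gam t ->
  ex_series (fun k => (s - t) * (d k / ((s + gam k) * (t + gam k)))) /\
  Kreal d gam t - Kreal d gam s =
    Series (fun k => (s - t) * (d k / ((s + gam k) * (t + gam k)))).
Proof.
intros Hg Hd Hs Ht.
destruct (Kreal_correct d gam s Hg Hd Hs) as [Es _].
destruct (Kreal_correct d gam t Hg Hd Ht) as [Et _].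
assert (E : forall k, d k / (t + gam k) - d k / (s + gam k) =
          (s - t) * (d k / ((s + gam k) * (t + gam k)))).
{ intros k; field; split; [apply Ht | apply Hs]. }
split.
- apply (ex_series_ext _ _ E).
  exact (ex_series_minus (V := R_NormedModule) _ _ Et Es).
- unfold Kreal; rewrite <- Series_minus by assumption.
  now apply Series_ext.
Qed.

Lemma Kreal_continuous (d gam : nat -> R) (t : R) :
  pole_seq gam -> weights d -> off_poles_real gam t ->
  continuity_pt (Kreal d gam) t.
Proof.
intros Hg Hd Ht.
destruct (pole_distance gam (RtoC t) Hg (proj2 (off_poles_RtoC _ _) Ht)) as [m [Hm Hb]].
assert (Hb' : forall k, m <= Rabs (t + gam k)).
{ intros k; specialize (Hb k); now rewrite <- RtoC_plus, Cmod_R in Hb. }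
set (B := Series d * / (m / 2 * m)).
assert (HB : 0 < B).
{ destruct Hd as [Hd1 Hd2]; apply Rmult_lt_0_compat; [now apply Series_gt_0|].
  apply Rinv_0_lt_compat; nra. }
intros eps Heps.
exists (Rmin (m / 2) (eps / B)); split.
{ apply Rmin_glb_lt; [lra|]; now apply Rdiv_lt_0_compat. }
intros s [_ Hs]; simpl in *; unfold Rdist in *.
assert (H1 : Rabs (s - t) < m / 2) by exact (Rlt_le_trans _ _ _ Hs (Rmin_l _ _)).
assert (H2 : Rabs (s - t) < eps / B) by exact (Rlt_le_trans _ _ _ Hs (Rmin_r _ _)).
assert (Hs' : forall k, m / 2 <= Rabs (s + gam k)).
{ intros k; specialize (Hb' k).
  generalize (Rabs_triang (s + gam k) (- (s - t))); rewrite Rabs_Ropp.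
  replace (s + gam k + - (s - t)) with (t + gam k) by ring; lra. }
assert (Os : off_poles_real gam s).
{ intros k E; specialize (Hs' k); rewrite E, Rabs_R0 in Hs'; lra. }
destruct (Kreal_diff d gam s t Hg Hd Os Ht) as [_ E].
rewrite Rabs_minus_sym, E, Series_scal_l, Rabs_mult.
assert (HS : Rabs (Series (fun k => d k / ((s + gam k) * (t + gam k)))) <= B).
{ unfold B; rewrite <- Series_scal_r; apply Rabs_Series_le.
  2: apply ex_series_scal_r, Hd.
  intros k; destruct Hd as [Hd _]; unfold Rdiv.
  rewrite Rabs_mult, Rabs_inv, Rabs_mult, (Rabs_pos_eq (d k)) by (left; apply Hd).
  apply Rmult_le_compat_l; [left; apply Hd|].
  apply Rinv_le_contravar; [nra|].
  apply Rmult_le_compat; [lra | lra | apply Hs' | apply Hb']. }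
apply Rle_lt_trans with (Rabs (s - t) * B).
- apply Rmult_le_compat_l; [apply Rabs_pos | exact HS].
- replace eps with (eps / B * B) by (field; lra).
  now apply Rmult_lt_compat_r.
Qed.

(** Unlike the gap from [-gam k] to [-gam_prev gam k], this is a whole component
    of the real line without the poles: for [k = 0] it is unbounded above, since
    [0] is not a pole. *)
Definition between_poles (gam : nat -> R) (k : nat) (t : R) : Prop :=
  forall j, ((j < k)%nat -> t + gam j < 0) /\ ((k <= j)%nat -> 0 < t + gam j).

Lemma pole_seq_le (gam : nat -> R) (i j : nat) :
  pole_seq gam -> (i <= j)%nat -> gam i <= gam j.
Proof.
intros [_ [H _]] Hij; induction Hij as [|j _ IH]; [lra|].
specialize (H j); lra.
Qed.

Lemma between_poles_intro (gam : nat -> R) (k : nat) (t : R) :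
  pole_seq gam -> - gam k < t -> (forall j, k = S j -> t < - gam j) ->
  between_poles gam k t.
Proof.
intros Hg H1 H2 j; split; intros Hj.
- destruct k as [|k]; [lia|].
  assert (j <= k)%nat as Hjk by lia.
  generalize (pole_seq_le gam j k Hg Hjk) (H2 k eq_refl); lra.
- generalize (pole_seq_le gam k j Hg Hj); lra.
Qed.

Lemma between_poles_off (gam : nat -> R) (k : nat) (t : R) :
  between_poles gam k t -> off_poles_real gam t.
Proof.
intros H j E; destruct (H j) as [H1 H2].
destruct (Nat.lt_ge_cases j k) as [Hj|Hj]; [specialize (H1 Hj) | specialize (H2 Hj)]; lra.
Qed.

(** The index is found by descending from some [N] with [-gam N < t]; such an
    [N] exists because [gam] tends to infinity. *)
Lemma off_poles_between (gam : nat -> R) (t : R) :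
  pole_seq gam -> off_poles_real gam t -> exists k, between_poles gam k t.
Proof.
intros Hg Ht.
destruct (proj2 (is_lim_seq_spec _ _) (proj2 (proj2 Hg)) (- t)) as [N HN].
specialize (HN N (Nat.le_refl N)).
induction N as [|N IH].
- exists 0%nat; apply between_poles_intro; [exact Hg | lra | intros j Hj; lia].
- destruct (Rlt_le_dec (- t) (gam N)) as [H|H]; [now apply IH|].
  exists (S N); apply between_poles_intro; [exact Hg | lra |].
  intros j Hj; injection Hj as <-.
  specialize (Ht N); lra.
Qed.

Lemma between_poles_mid (gam : nat -> R) (k : nat) (s t u : R) :
  between_poles gam k s -> between_poles gam k t -> s <= u <= t -> between_poles gam k u.
Proof.
intros Hs Ht Hu j; destruct (Hs j) as [_ Hs2]; destruct (Ht j) as [Ht1 _].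
split; intros Hj; [specialize (Ht1 Hj) | specialize (Hs2 Hj)]; lra.
Qed.

(** The difference quotient has terms [-d_j/((s + gam_j)(t + gam_j))], and the two
    factors have the same sign when no pole separates [s] and [t]. *)
Lemma Kreal_decreasing (d gam : nat -> R) (k : nat) (s t : R) :
  pole_seq gam -> weights d -> between_poles gam k s -> between_poles gam k t ->
  s < t -> Kreal d gam t < Kreal d gam s.
Proof.
intros Hg Hd Hs Ht Hst.
destruct (Kreal_diff d gam t s Hg Hd (between_poles_off _ _ _ Ht)
           (between_poles_off _ _ _ Hs)) as [E1 E2].
apply Rlt_0_minus; rewrite E2; apply Series_gt_0; [|exact E1].
intros j; apply Rmult_lt_0_compat; [lra|].
apply Rdiv_lt_0_compat; [apply Hd|].
destruct (Hs j) as [Hs1 Hs2]; destruct (Ht j) as [Ht1 Ht2].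
destruct (Nat.lt_ge_cases j k) as [Hj|Hj];
  [specialize (Hs1 Hj); specialize (Ht1 Hj) | specialize (Hs2 Hj); specialize (Ht2 Hj)]; nra.
Qed.

Lemma gam_prev_lt (gam : nat -> R) (k : nat) : pole_seq gam -> gam_prev gam k < gam k.
Proof. intros [H0 [H1 _]]; destruct k; [exact H0 | apply H1]. Qed.

Lemma gap_between_poles (gam : nat -> R) (k : nat) (t : R) :
  pole_seq gam -> - gam k < t -> t < - gam_prev gam k -> between_poles gam k t.
Proof.
intros Hg H1 H2; apply between_poles_intro; [exact Hg | exact H1 |].
now intros j ->.
Qed.

Lemma inv_small (M e : R) : 0 < e -> exists y, 0 < y /\ y <= e /\ M < / y.
Proof.
intros He; exists (Rmin e (/ (Rabs M + 1))).
assert (0 < / (Rabs M + 1)) by (apply Rinv_0_lt_compat; generalize (Rabs_pos M); lra).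
assert (0 < Rmin e (/ (Rabs M + 1))) by now apply Rmin_glb_lt.
split; [assumption|]; split; [apply Rmin_l|].
apply Rlt_le_trans with (/ / (Rabs M + 1)).
- rewrite Rinv_inv; generalize (Rle_abs M); lra.
- apply Rinv_le_contravar; [assumption | apply Rmin_r].
Qed.

Lemma Rdiv_le_far (d h w : R) : 0 < d -> 0 < h -> h <= w -> d / w <= d / h.
Proof.
intros Hd Hh Hw; apply Rmult_le_compat_l; [lra|]; now apply Rinv_le_contravar.
Qed.

(** Close to [-gam k] on its right, the term of index [k] is large, the later
    terms are positive, and the earlier ones are at least [-d_j/g] where [g] is
    half the length of the gap. *)
Lemma Kreal_right_of_pole (d gam : nat -> R) (k : nat) (b M : R) :
  pole_seq gam -> weights d -> - gam k < b ->
  exists t, - gam k < t < b /\ between_poles gam k t /\ M < Kreal d gam t.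
Proof.
intros Hg Hd Hb.
set (g := (gam k - gam_prev gam k) / 2).
assert (Hgp : 0 < g) by (generalize (gam_prev_lt gam k Hg); unfold g; lra).
set (D := Series (fun j => d j * / g)).
destruct (inv_small ((M + D) / d k) (Rmin g ((b + gam k) / 2))) as [y [Hy [Hye HyM]]].
{ apply Rmin_glb_lt; lra. }
assert (Hy1 := Rle_trans _ _ _ Hye (Rmin_l _ _)).
assert (Hy2 := Rle_trans _ _ _ Hye (Rmin_r _ _)).
assert (Hbt : between_poles gam k (- gam k + y)).
{ apply gap_between_poles; [exact Hg | lra | unfold g in *; lra]. }
exists (- gam k + y); split; [lra|]; split; [exact Hbt|].
destruct (Kreal_correct d gam _ Hg Hd (between_poles_off _ _ _ Hbt)) as [E _].
assert (E' : ex_series (fun j => d j * / g)) by apply ex_series_scal_r, Hd.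
assert (Hk : 0 < d k) by apply Hd.
assert (HS : d k * / y <= Kreal d gam (- gam k + y) + D).
{ unfold Kreal, D; rewrite <- Series_plus by assumption.
  set (u := fun j => d j / (- gam k + y + gam j) + d j * / g).
  apply Rle_trans with (u k).
  - unfold u; replace (- gam k + y + gam k) with y by ring.
    assert (0 < / g) by now apply Rinv_0_lt_compat.
    unfold Rdiv; nra.
  - apply Series_ge_term; [|exact (ex_series_plus (V := R_NormedModule) _ _ E E')].
    intros j; unfold u; destruct (Hbt j) as [H1 H2].
    assert (Hj : 0 < d j) by apply Hd.
    assert (0 < d j / g) by now apply Rdiv_lt_0_compat.
    destruct (Nat.lt_ge_cases j k) as [Hjk|Hjk].
    + assert (gam j <= gam_prev gam k).
      { destruct k as [|k]; [lia|]; apply (pole_seq_le gam j k); [exact Hg | lia]. }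
      generalize (Rdiv_le_far (d j) g (- (- gam k + y + gam j)) Hj Hgp).
      specialize (H1 Hjk).
      replace (d j / - (- gam k + y + gam j)) with (- (d j / (- gam k + y + gam j)))
        by (field; lra).
      unfold g, Rdiv in *; lra.
    + assert (0 < d j / (- gam k + y + gam j)) by (apply Rdiv_lt_0_compat; [exact Hj | now apply H2]).
      unfold Rdiv in *; lra. }
apply (Rmult_lt_compat_r (d k)) in HyM; [|exact Hk].
replace ((M + D) / d k * d k) with (M + D) in HyM by (field; lra).
lra.
Qed.

(** The mirror image: here the term of index [k] is very negative, the earlier
    terms are negative, and the later ones are at most [d_j/g]. *)
Lemma Kreal_left_of_pole (d gam : nat -> R) (k : nat) (M : R) :
  pole_seq gam -> weights d ->
  exists t, between_poles gam (S k) t /\ Kreal d gam t < M.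
Proof.
intros Hg Hd.
set (g := (gam (S k) - gam k) / 2).
assert (Hgp : 0 < g) by (generalize (gam_prev_lt gam (S k) Hg); simpl; unfold g; lra).
set (D := Series (fun j => d j * / g)).
destruct (inv_small ((D - M) / d k) g Hgp) as [y [Hy [Hye HyM]]].
assert (Hbt : between_poles gam (S k) (- gam k - y)).
{ apply gap_between_poles; [exact Hg | unfold g in *; lra | simpl; lra]. }
exists (- gam k - y); split; [exact Hbt|].
destruct (Kreal_correct d gam _ Hg Hd (between_poles_off _ _ _ Hbt)) as [E _].
assert (E' : ex_series (fun j => d j * / g)) by apply ex_series_scal_r, Hd.
assert (Hk : 0 < d k) by apply Hd.
assert (HS : d k * / y <= D - Kreal d gam (- gam k - y)).
{ unfold Kreal, D; rewrite <- Series_minus by assumption.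
  set (u := fun j => d j * / g - d j / (- gam k - y + gam j)).
  apply Rle_trans with (u k).
  - unfold u; replace (- gam k - y + gam k) with (- y) by ring.
    assert (0 < / g) by now apply Rinv_0_lt_compat.
    replace (d k / - y) with (- (d k * / y)) by (field; lra).
    nra.
  - apply Series_ge_term; [|exact (ex_series_minus (V := R_NormedModule) _ _ E' E)].
    intros j; unfold u; destruct (Hbt j) as [H1 H2].
    assert (Hj : 0 < d j) by apply Hd.
    assert (0 < d j / g) by now apply Rdiv_lt_0_compat.
    destruct (Nat.lt_ge_cases j (S k)) as [Hjk|Hjk].
    + specialize (H1 Hjk).
      assert (0 < d j / - (- gam k - y + gam j)) by (apply Rdiv_lt_0_compat; lra).
      replace (d j / - (- gam k - y + gam j)) with (- (d j / (- gam k - y + gam j))) in *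
        by (field; lra).
      unfold Rdiv in *; lra.
    + generalize (pole_seq_le gam (S k) j Hg Hjk); intros Hle.
      generalize (Rdiv_le_far (d j) g (- gam k - y + gam j) Hj Hgp).
      unfold g, Rdiv in *; lra. }
apply (Rmult_lt_compat_r (d k)) in HyM; [|exact Hk].
replace ((D - M) / d k * d k) with (D - M) in HyM by (field; lra).
lra.
Qed.

(** Poles to the right of [t] contribute negative terms, and among those to
    its left [-gam k] is the nearest, so gaps may be arbitrarily short without
    spoiling the bound. *)
Lemma Kreal_le_dist (d gam : nat -> R) (k : nat) (t : R) :
  pole_seq gam -> weights d -> between_poles gam k t ->
  Kreal d gam t <= Series d / (t + gam k).
Proof.
intros Hg Hd Ht.
destruct (Kreal_correct d gam t Hg Hd (between_poles_off _ _ _ Ht)) as [E _].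
assert (Hk : 0 < t + gam k) by now apply (Ht k).
assert (E' : ex_series (fun j => d j * / (t + gam k))) by apply ex_series_scal_r, Hd.
unfold Rdiv; rewrite <- Series_scal_r.
apply Rminus_le_0; unfold Kreal; rewrite <- Series_minus by assumption.
apply Series_ge_0; [|exact (ex_series_minus (V := R_NormedModule) _ _ E' E)].
intros j; assert (Hj : 0 < d j) by apply Hd.
destruct (Ht j) as [H1 H2]; destruct (Nat.lt_ge_cases j k) as [L|L].
- specialize (H1 L).
  assert (0 < d j * / (t + gam k)) by now apply Rdiv_lt_0_compat.
  assert (0 < d j / - (t + gam j)) by (apply Rdiv_lt_0_compat; lra).
  replace (d j / - (t + gam j)) with (- (d j / (t + gam j))) in * by (field; lra).
  lra.
- assert (Hle := pole_seq_le gam k j Hg L).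
  generalize (Rdiv_le_far (d j) (t + gam k) (t + gam j) Hj Hk); unfold Rdiv; lra.
Qed.

Lemma Kreal_one_between (d gam : nat -> R) (k : nat) (b : R) :
  pole_seq gam -> weights d -> between_poles gam k b -> Kreal d gam b < 1 ->
  exists x, between_poles gam k x /\ x < b /\ Kreal d gam x = 1.
Proof.
intros Hg Hd Hb Kb.
assert (Hb0 : - gam k < b) by (generalize (proj2 (Hb k) (Nat.le_refl k)); lra).
destruct (Kreal_right_of_pole d gam k b 1 Hg Hd Hb0) as [t [Ht [Hbt Kt]]].
destruct (IVT_interv (fun s => 1 - Kreal d gam s) t b) as [x [Hx Ex]];
  cbv beta; try lra.
- intros s Hs; apply continuity_pt_minus; [apply continuity_pt_const; now intros ? ?|].
  apply Kreal_continuous; [exact Hg | exact Hd |].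
  apply (between_poles_off _ k); now apply (between_poles_mid _ _ t b).
- exists x; split; [now apply (between_poles_mid _ _ t b)|]; split; [|lra].
  destruct (Rle_lt_or_eq_dec _ _ (proj2 Hx)) as [H|H]; [exact H | subst; lra].
Qed.

(** In the gap of index 0 the right end [0] is not a pole, and there the hypothesis on
    the value [sum d_j/gam_j] replaces the behaviour at a pole. *)
Lemma Kreal_one_in_gap (d gam : nat -> R) (k : nat) :
  pole_seq gam -> weights d -> Series (fun j => d j / gam j) < 1 ->
  exists x, - gam k < x < - gam_prev gam k /\ Kreal d gam x = 1.
Proof.
intros Hg Hd H0.
assert (exists b, between_poles gam k b /\ b <= - gam_prev gam k /\ Kreal d gam b < 1)
  as [b [Hb [Hb' Kb]]].
{ destruct k as [|k].
  - exists 0; split; [|split].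
    + apply between_poles_intro; [exact Hg | destruct Hg; lra | intros j Hj; lia].
    + simpl; lra.
    + unfold Kreal; rewrite (Series_ext _ (fun j => d j / gam j)); [exact H0|].
      intros j; now rewrite Rplus_0_l.
  - destruct (Kreal_left_of_pole d gam k 1 Hg Hd) as [b [Hb Kb]].
    exists b; split; [exact Hb|]; split; [|exact Kb].
    generalize (proj1 (Hb k) (Nat.lt_succ_diag_r k)); simpl; lra. }
destruct (Kreal_one_between d gam k b Hg Hd Hb Kb) as [x [Hx [Hxb Kx]]].
exists x; split; [|exact Kx].
generalize (proj2 (Hx k) (Nat.le_refl k)); lra.
Qed.

(** Every [Im (d_k/(z + gam_k))] has the sign opposite to that of [Im z]. *)
Lemma Khat_nonreal (d gam : nat -> R) (z : C) :
  pole_seq gam -> weights d -> Im z <> 0 -> Im (Khat d gam z) <> 0.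
Proof.
intros Hg Hd Hz.
destruct (Khat_correct d gam z Hg Hd (off_poles_im gam z Hz)) as [_ H].
set (u := fun k => d k / ((Re z + gam k) ^ 2 + Im z ^ 2)).
assert (P : forall k, 0 < (Re z + gam k) ^ 2 + Im z ^ 2) by
  (intros k; generalize (pow2_ge_0 (Re z + gam k)) (pow2_gt_0 _ Hz); lra).
assert (E : forall k, Im (RtoC (d k) / (z + RtoC (gam k))) = - Im z * u k).
{ intros k; specialize (P k); unfold u; destruct z as [x y]; simpl in *.
  field. intros E; apply Rgt_not_eq in P; apply P; rewrite <- E; ring. }
apply (is_series_ext _ _ _ E) in H.
assert (Eu : ex_series u).
{ assert (Eu : forall k, / (- Im z) * (- Im z * u k) = u k)
    by (intros k; field; exact Hz).
  apply (ex_series_ext _ _ Eu).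
  eexists; exact (is_series_scal (V := R_NormedModule) _ _ _ H). }
apply is_series_unique in H; rewrite <- H, Series_scal_l.
apply Rmult_integral_contrapositive_currified; [lra|].
apply Rgt_not_eq, Series_gt_0; [|exact Eu].
intros k; apply Rdiv_lt_0_compat; [apply Hd | apply P].
Qed.

Lemma one_minus_Khat_zeros (d gam x : nat -> R) (z : C) :
  pole_seq gam -> weights d ->
  (forall k, - gam k < x k < - gam_prev gam k /\ Kreal d gam (x k) = 1) ->
  mero_zero gam (fun w => 1 - Khat d gam w)%C z <-> exists k, z = RtoC (x k).
Proof.
intros Hg Hd Hx; split.
- intros [Hz E].
  assert (HK : Khat d gam z = RtoC 1).
  { replace (Khat d gam z) with (1 - (1 - Khat d gam z))%C by ring.
    rewrite E; ring. }
  destruct (Req_dec (Im z) 0) as [Iz|Iz].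
  2: { exfalso; apply (Khat_nonreal d gam z Hg Hd Iz); now rewrite HK. }
  destruct z as [t i]; simpl in Iz; subst i; change (t, 0) with (RtoC t) in *.
  apply off_poles_RtoC in Hz.
  rewrite (proj2 (Kreal_correct d gam t Hg Hd Hz)) in HK; apply RtoC_inj in HK.
  destruct (off_poles_between gam t Hg Hz) as [k Hk]; exists k.
  destruct (Hx k) as [[X1 X2] X3].
  assert (Bx := gap_between_poles gam k _ Hg X1 X2).
  destruct (Rtotal_order t (x k)) as [L|[L|L]].
  + generalize (Kreal_decreasing d gam k _ _ Hg Hd Hk Bx L); lra.
  + now rewrite L.
  + generalize (Kreal_decreasing d gam k _ _ Hg Hd Bx Hk L); lra.
- intros [k ->]; destruct (Hx k) as [[X1 X2] X3].
  assert (O := between_poles_off _ _ _ (gap_between_poles gam k _ Hg X1 X2)).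
  split; [now apply off_poles_RtoC|].
  rewrite (proj2 (Kreal_correct d gam _ Hg Hd O)), X3; ring.
Qed.

(** * Dividing out a pair of conjugate zeros *)

(** Newton interpolation of [A phi], [phi(z) = d_k/(z + gam_k)], at [z0] and [conj z0]
    has the remainder
      [(z - z0)(z - conj z0) A d_k/((z + gam_k)(z0 + gam_k)(conj z0 + gam_k))],
    which is a simple fraction with positive weight [e_k].  Summed over [k],
    the interpolant of [A K] is that of [z^2 + A], because the two
    functions agree at the zeros [z0] and [conj z0] of their difference. *)
Lemma factor_nonreal_zero (A : R) (d gam : nat -> R) (z0 z : C) :
  pole_seq gam -> weights d -> 0 < A -> Im z0 <> 0 ->
  (z0 ^ 2 + RtoC A * (1 - Khat d gam z0))%C = RtoC 0 ->
  off_poles gam z ->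
  let e := fun k => A * d k / Cmod (z0 + RtoC (gam k)) ^ 2 in
  weights e /\
  (z ^ 2 + RtoC A * (1 - Khat d gam z))%C =
  ((z - z0) * (z - Cconj z0) * (1 - Khat e gam z))%C.
Proof.
intros Hg Hd HA I0 E0 Hz e.
assert (O0 := off_poles_im gam z0 I0).
assert (I0' : Im (Cconj z0) <> 0) by (rewrite im_conj; lra).
assert (O0' := off_poles_im gam _ I0').
assert (P : forall k, 0 < Cmod (z0 + RtoC (gam k))) by
  (intros k; now apply Cmod_gt_0, off_poles_neq).
assert (He : weights e).
{ split.
  - intros k; apply Rdiv_lt_0_compat; [apply Rmult_lt_0_compat; [exact HA | apply Hd]|].
    now apply pow_lt.
  - assert (HI : 0 < Im z0 ^ 2) by now apply pow2_gt_0.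
    apply (Rabs_Series_le e (fun k => (A / Im z0 ^ 2) * d k)).
    2: exact (ex_series_scal_l (A / Im z0 ^ 2) d (proj2 Hd)).
    intros k; assert (Hk : 0 < d k) by apply Hd.
    assert (HM : Im z0 ^ 2 <= Cmod (z0 + RtoC (gam k)) ^ 2).
    { rewrite <- (pow2_abs (Im z0)); apply pow_incr; split; [apply Rabs_pos|].
      replace (Im z0) with (Im (z0 + RtoC (gam k))) by (unfold Im; simpl; ring).
      apply im_le_Cmod. }
    unfold e; rewrite Rabs_pos_eq.
    2: { left; apply Rdiv_lt_0_compat; [nra | now apply pow_lt]. }
    replace (A / Im z0 ^ 2 * d k) with (A * d k / Im z0 ^ 2) by (field; lra).
    apply Rdiv_le_far; [nra | exact HI | exact HM]. }
split; [exact He|].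
assert (N : (z0 - Cconj z0)%C <> RtoC 0).
{ intros E; apply I0; apply (f_equal Im) in E; simpl in E; unfold Im; lra. }
(* The interpolant takes [phi z0] with coefficient [A + b], [phi (conj z0)] with [-b]. *)
set (b := ((z - z0) * RtoC A / (z0 - Cconj z0))%C).
assert (K0 : (RtoC A * Khat d gam z0 = z0 ^ 2 + RtoC A)%C).
{ replace (RtoC A * Khat d gam z0)%C with
    (z0 ^ 2 + RtoC A - (z0 ^ 2 + RtoC A * (1 - Khat d gam z0)))%C by ring.
  rewrite E0; ring. }
assert (K0' : (RtoC A * Khat d gam (Cconj z0) = Cconj z0 ^ 2 + RtoC A)%C).
{ rewrite Khat_conj by assumption.
  apply (f_equal Cconj) in K0.
  rewrite Cmult_conj, Cplus_conj, Cpow_conj in K0.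
  replace (Cconj (RtoC A)) with (RtoC A) in K0
    by (unfold Cconj, RtoC; simpl; now rewrite Ropp_0).
  exact K0. }
assert (S1 : is_CSeries
  (fun k => (z - z0) * (z - Cconj z0) * (RtoC (e k) / (z + RtoC (gam k))))%C
  ((z - z0) * (z - Cconj z0) * Khat e gam z)%C)
  by now apply is_CSeries_scal, Khat_correct.
assert (S2 : is_CSeries
  (fun k => RtoC A * (RtoC (d k) / (z + RtoC (gam k))) +
     ((- RtoC A - b) * (RtoC (d k) / (z0 + RtoC (gam k))) +
      b * (RtoC (d k) / (Cconj z0 + RtoC (gam k)))))%C
  (RtoC A * Khat d gam z +
     ((- RtoC A - b) * Khat d gam z0 + b * Khat d gam (Cconj z0)))%C).
{ apply is_CSeries_plus; [|apply is_CSeries_plus];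
    now apply is_CSeries_scal, Khat_correct. }
apply (is_CSeries_ext _ (fun k => (z - z0) * (z - Cconj z0) *
         (RtoC (e k) / (z + RtoC (gam k))))%C) in S2.
2: { intros k.
  assert (Q1 := off_poles_neq gam z k Hz).
  assert (Q2 := off_poles_neq gam z0 k O0).
  assert (Q3 := off_poles_neq gam _ k O0').
  replace (RtoC (e k)) with
    (RtoC A * RtoC (d k) / ((z0 + RtoC (gam k)) * (Cconj z0 + RtoC (gam k))))%C.
  - unfold b; field; repeat split; assumption.
  - unfold e; rewrite RtoC_div, RtoC_mult, Cmod2_conj, Cplus_conj.
    + do 3 f_equal; unfold Cconj, RtoC; simpl; now rewrite Ropp_0.
    + apply Rgt_not_eq, pow_lt, P. }
apply is_CSeries_unique in S1; apply is_CSeries_unique in S2.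
rewrite S2 in S1.
replace ((z - z0) * (z - Cconj z0) * (1 - Khat e gam z))%C with
  ((z - z0) * (z - Cconj z0) - (z - z0) * (z - Cconj z0) * Khat e gam z)%C by ring.
rewrite <- S1.
replace ((- RtoC A - b) * Khat d gam z0 + b * Khat d gam (Cconj z0))%C with
  (- (RtoC A * Khat d gam z0) - (z - z0) / (z0 - Cconj z0) *
     (RtoC A * Khat d gam z0 - RtoC A * Khat d gam (Cconj z0)))%C
  by (unfold b; field; exact N).
rewrite K0, K0'; field; exact N.
Qed.

(** The cofactor in the factorization vanishes at every [mu k], so it has no room
    for further zeros: each gap holds exactly one. *)
Lemma quadratic_zeros (A : R) (d gam mu : nat -> R) (z0 z : C) :
  pole_seq gam -> weights d -> 0 < A -> Im z0 <> 0 ->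
  (z0 ^ 2 + RtoC A * (1 - Khat d gam z0))%C = RtoC 0 ->
  (forall k, - gam k < mu k < - gam_prev gam k /\
     mu k ^ 2 + A * (1 - Kreal d gam (mu k)) = 0) ->
  mero_zero gam (fun w => w ^ 2 + RtoC A * (1 - Khat d gam w))%C z <->
  ((exists k, z = RtoC (mu k)) \/ z = z0 \/ z = Cconj z0).
Proof.
intros Hg Hd HA I0 E0 Hmu.
destruct (factor_nonreal_zero A d gam z0 z0 Hg Hd HA I0 E0 (off_poles_im _ _ I0)) as [He _].
set (e := fun k => A * d k / Cmod (z0 + RtoC (gam k)) ^ 2) in He.
assert (F : forall w, off_poles gam w ->
  (w ^ 2 + RtoC A * (1 - Khat d gam w))%C =
  ((w - z0) * (w - Cconj z0) * (1 - Khat e gam w))%C).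
{ intros w Hw; now apply (factor_nonreal_zero A d gam z0 w Hg Hd HA I0 E0 Hw). }
assert (Hmu' : forall k, - gam k < mu k < - gam_prev gam k /\ Kreal e gam (mu k) = 1).
{ intros k; destruct (Hmu k) as [[H1 H2] H3]; split; [split; assumption|].
  assert (O := between_poles_off _ _ _ (gap_between_poles gam k _ Hg H1 H2)).
  assert (Ez := F (RtoC (mu k)) (proj2 (off_poles_RtoC _ _) O)).
  rewrite (proj2 (Kreal_correct d gam _ Hg Hd O)),
    (proj2 (Kreal_correct e gam _ Hg He O)) in Ez.
  rewrite <- RtoC_pow, <- !RtoC_minus, <- RtoC_mult, <- RtoC_plus, H3 in Ez.
  symmetry in Ez; apply Cmult_integral in Ez; destruct Ez as [Ez|Ez].
  - exfalso; apply I0; apply Cmult_integral in Ez.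
    destruct Ez as [Ez|Ez]; apply (f_equal Im) in Ez; simpl in Ez; unfold Im; lra.
  - apply RtoC_inj in Ez; lra. }
assert (Z := fun w => one_minus_Khat_zeros e gam mu w Hg He Hmu').
split.
- intros [Hz E]; rewrite F in E by exact Hz.
  apply Cmult_integral in E; destruct E as [E|E].
  + right; apply Cmult_integral in E; destruct E as [E|E]; [left|right].
    * replace z with (z - z0 + z0)%C by ring; rewrite E; ring.
    * replace z with (z - Cconj z0 + Cconj z0)%C by ring; rewrite E; ring.
  + left; apply Z; now split.
- intros [H|[->| ->]].
  + apply Z in H; destruct H as [H1 H2]; split; [exact H1|].
    rewrite F, H2 by exact H1; ring.
  + split; [now apply off_poles_im | exact E0].
  + assert (off_poles gam (Cconj z0)) by (apply off_poles_im; rewrite im_conj; lra).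
    split; [assumption|]; rewrite F by assumption; ring.
Qed.

(** At [x] the quadratic term alone survives and is positive; near the pole
    [A (1 - K)] falls below [-gam_k^2], while [t^2 < gam_k^2] throughout the gap. *)
Lemma quadratic_zero_left (A : R) (d gam : nat -> R) (k : nat) (x : R) :
  pole_seq gam -> weights d -> 0 < A ->
  - gam k < x < - gam_prev gam k -> Kreal d gam x = 1 ->
  exists mu, - gam k < mu < x /\ mu ^ 2 + A * (1 - Kreal d gam mu) = 0.
Proof.
intros Hg Hd HA [X1 X2] X3.
assert (Bx := gap_between_poles gam k _ Hg X1 X2).
assert (x < 0).
{ assert (0 <= gam_prev gam k); [|lra].
  destruct k as [|k]; simpl; [lra|].
  generalize (pole_seq_le gam 0 k Hg (Nat.le_0_l k)); destruct Hg; lra. }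
destruct (Kreal_right_of_pole d gam k x (1 + gam k ^ 2 / A) Hg Hd X1) as [t [Ht [Bt Kt]]].
destruct (IVT_interv (fun s => s ^ 2 + A * (1 - Kreal d gam s)) t x) as [mu [Hm Em]];
  cbv beta.
- intros s Hs; apply continuity_pt_plus.
  + apply derivable_continuous_pt, derivable_pt_pow.
  + apply continuity_pt_mult; [apply continuity_pt_const; now intros ? ?|].
    apply continuity_pt_minus; [apply continuity_pt_const; now intros ? ?|].
    apply Kreal_continuous; [exact Hg | exact Hd |].
    apply (between_poles_off _ k); now apply (between_poles_mid _ _ t x).
- lra.
- assert (Ht2 : t ^ 2 < gam k ^ 2) by nra.
  assert (A * (1 + gam k ^ 2 / A) < A * Kreal d gam t) by now apply Rmult_lt_compat_l.
  replace (A * (1 + gam k ^ 2 / A)) with (A + gam k ^ 2) in * by (field; lra).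
  lra.
- rewrite X3; nra.
- exists mu; split; [|exact Em].
  split; [lra|].
  destruct (Rle_lt_or_eq_dec _ _ (proj2 Hm)) as [H1|H1]; [exact H1 | subst mu].
  rewrite X3 in Em; nra.
Qed.

(** * A nonreal zero near the imaginary axis *)

(** The increments of the iteration are dominated by a geometric series, whose
    sum, added to the centre, is the limit. *)
Lemma contraction_fixed_point (T : C -> C) (c0 : C) (r : R) :
  0 <= r ->
  (forall z, Cmod (z - c0) <= r -> Cmod (T z - c0) <= r) ->
  (forall z w, Cmod (z - c0) <= r -> Cmod (w - c0) <= r ->
     Cmod (T z - T w) <= / 2 * Cmod (z - w)) ->
  exists z, Cmod (z - c0) <= r /\ T z = z.
Proof.
intros Hr HT HL.
set (zs := fun m => Nat.iter m T c0).
assert (Hin : forall m, Cmod (zs m - c0) <= r).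
{ induction m as [|m IH]; [|exact (HT _ IH)].
  unfold zs; simpl; replace (c0 - c0)%C with (RtoC 0) by ring.
  now rewrite Cmod_0. }
set (u := fun m => (zs (S m) - zs m)%C).
assert (Hu : forall m, Cmod (u m) <= r * (/ 2) ^ m).
{ induction m as [|m IH].
  - simpl; rewrite Rmult_1_r; exact (Hin 1%nat).
  - apply Rle_trans with (1 := HL _ _ (Hin (S m)) (Hin m)).
    unfold u in IH; simpl pow; lra. }
destruct (CSeries_dominated u (fun m => r * (/ 2) ^ m) Hu) as [[S1 S2] _].
{ apply (ex_series_scal_l r (fun m => (/ 2) ^ m)), ex_series_geom.
  rewrite Rabs_pos_eq; lra. }
set (z := (c0 + CSeries u)%C).
assert (Hlim : forall eps, 0 < eps -> exists N, forall m, (N <= m)%nat ->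
          Cmod (zs m - z) < eps).
{ intros eps Heps.
  assert (H1 : is_lim_seq (sum_n (fun k => Re (u k))) (Re (CSeries u))) by exact S1.
  assert (H2 : is_lim_seq (sum_n (fun k => Im (u k))) (Im (CSeries u))) by exact S2.
  assert (T1 : forall m, sum_n (fun k => Re (u k)) m = Re (zs (S m)) - Re c0).
  { induction m as [|m IH]; [rewrite sum_O; reflexivity|].
    rewrite sum_Sn, IH; unfold plus; simpl; unfold u, Re; simpl; ring. }
  assert (T2 : forall m, sum_n (fun k => Im (u k)) m = Im (zs (S m)) - Im c0).
  { induction m as [|m IH]; [rewrite sum_O; reflexivity|].
    rewrite sum_Sn, IH; unfold plus; simpl; unfold u, Im; simpl; ring. }
  apply is_lim_seq_spec in H1; apply is_lim_seq_spec in H2.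
  assert (He2 : 0 < eps / 2) by lra.
  destruct (H1 (mkposreal _ He2)) as [N1 HN1].
  destruct (H2 (mkposreal _ He2)) as [N2 HN2].
  exists (S (Nat.max N1 N2)); intros m Hm; destruct m as [|m]; [lia|].
  specialize (HN1 m ltac:(lia)); specialize (HN2 m ltac:(lia)).
  rewrite T1 in HN1; rewrite T2 in HN2; simpl pos in *.
  apply Rle_lt_trans with (1 := Cmod_le_abs _).
  replace (Re (zs (S m) - z)) with (Re (zs (S m)) - Re c0 - Re (CSeries u))
    by (unfold z, Re; simpl; ring).
  replace (Im (zs (S m) - z)) with (Im (zs (S m)) - Im c0 - Im (CSeries u))
    by (unfold z, Im; simpl; ring).
  lra. }
assert (Hz : Cmod (z - c0) <= r).
{ apply le_epsilon; intros eps Heps.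
  destruct (Hlim eps Heps) as [N HN]; specialize (HN N (Nat.le_refl N)).
  replace (z - c0)%C with ((zs N - c0) + - (zs N - z))%C by ring.
  apply Rle_trans with (1 := Cmod_triangle _ _).
  rewrite Cmod_opp; specialize (Hin N); lra. }
exists z; split; [exact Hz|].
assert (H0 : Cmod (T z - z) = 0).
{ apply Rle_antisym; [|apply Cmod_ge_0].
  apply le_epsilon; intros eps Heps.
  assert (He2 : 0 < eps / 2) by lra.
  destruct (Hlim _ He2) as [N HN].
  assert (HN1 := HN N (Nat.le_refl N)); assert (HN2 := HN (S N) (Nat.le_succ_diag_r N)).
  replace (T z - z)%C with (- (T (zs N) - T z) + (zs (S N) - z))%C
    by (unfold zs; simpl; ring).
  apply Rle_trans with (1 := Cmod_triangle _ _).
  rewrite Cmod_opp; specialize (HL _ _ (Hin N) Hz); lra. }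
apply Cmod_eq_0 in H0.
replace (T z) with (T z - z + z)%C by ring; rewrite H0; ring.
Qed.

Lemma Khat_lipschitz (d gam : nat -> R) (z w : C) (m : R) :
  weights d -> 0 < m -> (forall k, m <= Cmod (z + RtoC (gam k))) ->
  (forall k, m <= Cmod (w + RtoC (gam k))) ->
  Cmod (Khat d gam z - Khat d gam w) <= 2 * (Series d / m ^ 2) * Cmod (z - w).
Proof.
intros Hd Hm Hz Hw.
destruct (Khat_bound d gam z m Hd Hm Hz) as [Sz _].
destruct (Khat_bound d gam w m Hd Hm Hw) as [Sw _].
assert (Hm2 : 0 < m ^ 2) by now apply pow_lt.
set (u := fun k => (RtoC (d k) / (z + RtoC (gam k)) +
                    (- 1) * (RtoC (d k) / (w + RtoC (gam k))))%C).
assert (Su : is_CSeries u (Khat d gam z + (- 1) * Khat d gam w)%C).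
{ apply is_CSeries_plus; [exact Sz | now apply is_CSeries_scal]. }
destruct (CSeries_dominated u (fun k => d k * (/ m ^ 2 * Cmod (z - w)))) as [_ B].
- intros k.
  assert (Nz : (z + RtoC (gam k))%C <> RtoC 0) by (apply Cmod_gt_0; specialize (Hz k); lra).
  assert (Nw : (w + RtoC (gam k))%C <> RtoC 0) by (apply Cmod_gt_0; specialize (Hw k); lra).
  assert (Hk : 0 < d k) by apply Hd.
  replace (u k) with
    (RtoC (d k) / ((z + RtoC (gam k)) * (w + RtoC (gam k))) * - (z - w))%C
    by (unfold u; field; split; assumption).
  rewrite Cmod_mult, Cmod_opp, <- Rmult_assoc.
  apply Rmult_le_compat_r; [apply Cmod_ge_0|].
  apply Cmod_frac_le; [exact Hk | exact Hm2 |].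
  rewrite Cmod_mult; simpl; rewrite Rmult_1_r.
  apply Rmult_le_compat; [lra | lra | apply Hz | apply Hw].
- apply ex_series_scal_r, Hd.
- rewrite (is_CSeries_unique _ _ Su), Series_scal_r in B.
  replace (Khat d gam z - Khat d gam w)%C with (Khat d gam z + (- 1) * Khat d gam w)%C by ring.
  apply Rle_trans with (1 := B); right; field; lra.
Qed.

(** The zeros are the solutions of [(z - i a)(z + i a) = a^2 K(z)].  Solving for
    the first factor gives a contraction of the unit disc about [i a]: there
    [Im z >= a/2], which makes [K] of size [D/a] and its Lipschitz constant of size
    [D/a^2], where [D = sum d_k]. *)
Lemma quadratic_nonreal_zero (a : R) (d gam : nat -> R) :
  pole_seq gam -> weights d -> 2 <= a -> 12 * Series d <= 1 ->
  exists z, Cmod (z - Ci * RtoC a) <= 4 * Series d /\ 0 < Im z /\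
    (z ^ 2 + RtoC (a ^ 2) * (1 - Khat d gam z))%C = RtoC 0.
Proof.
intros Hg Hd Ha HD.
set (D := Series d) in *.
assert (HD0 : 0 < D) by (apply Series_gt_0; apply Hd).
set (c0 := (Ci * RtoC a)%C).
set (T := fun z => (c0 + RtoC (a ^ 2) * Khat d gam z / (z + c0))%C).
assert (Ic0 : Im c0 = a) by (unfold c0, Im; simpl; ring).
assert (HI : forall z, Cmod (z - c0) <= 1 -> a / 2 <= Im z).
{ intros z Hz; generalize (Rle_trans _ _ _ (im_le_Cmod _) Hz); intros H.
  replace (Im (z - c0)) with (Im z - Im c0) in H by (unfold Im; simpl; ring).
  rewrite Ic0 in H; apply Rabs_le_between in H; lra. }
assert (Hm : forall z, Cmod (z - c0) <= 1 -> forall k, a / 2 <= Cmod (z + RtoC (gam k))).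
{ intros z Hz k; apply Rle_trans with (1 := HI z Hz).
  apply Rle_trans with (2 := im_le_Cmod _); apply Rle_trans with (2 := Rle_abs _).
  unfold Im; simpl; lra. }
assert (Hc : forall z, Cmod (z - c0) <= 1 -> a <= Cmod (z + c0)).
{ intros z Hz; specialize (HI z Hz).
  apply Rle_trans with (2 := im_le_Cmod _); apply Rle_trans with (2 := Rle_abs _).
  replace (Im (z + c0)) with (Im z + Im c0) by (unfold Im; simpl; ring); lra. }
assert (Hc0 : forall z, Cmod (z - c0) <= 1 -> (z + c0)%C <> RtoC 0).
{ intros z Hz; apply Cmod_gt_0; specialize (Hc z Hz); lra. }
assert (Ha2 : 0 < a / 2) by lra.
assert (HK : forall z, Cmod (z - c0) <= 1 -> Cmod (Khat d gam z) <= 4 * D / a).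
{ intros z Hz; destruct (Khat_bound d gam z (a / 2) Hd Ha2 (Hm z Hz)) as [_ H].
  apply Rle_trans with (1 := H); right; unfold D; field; lra. }
assert (HT : forall z, Cmod (z - c0) <= 1 -> Cmod (T z - c0) <= 4 * D).
{ intros z Hz; unfold T.
  replace (c0 + RtoC (a ^ 2) * Khat d gam z / (z + c0) - c0)%C with
    (RtoC (a ^ 2) * Khat d gam z / (z + c0))%C by ring.
  rewrite Cmod_div, Cmod_mult, Cmod_R, Rabs_pos_eq by (try apply Hc0; try assumption; nra).
  apply Rle_trans with (a ^ 2 * (4 * D / a) * / a); [|right; field; lra].
  apply Rmult_le_compat.
  - apply Rmult_le_pos; [nra | apply Cmod_ge_0].
  - left; apply Rinv_0_lt_compat; specialize (Hc z Hz); lra.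
  - apply Rmult_le_compat_l; [nra | now apply HK].
  - apply Rinv_le_contravar; [lra | now apply Hc]. }
assert (HL : forall z w, Cmod (z - c0) <= 1 -> Cmod (w - c0) <= 1 ->
          Cmod (T z - T w) <= / 2 * Cmod (z - w)).
{ intros z w Hz Hw.
  assert (Nz := Hc0 z Hz); assert (Nw := Hc0 w Hw).
  replace (T z - T w)%C with
    (RtoC (a ^ 2) * ((Khat d gam z - Khat d gam w) / (z + c0) +
      Khat d gam w * (- (z - w)) / ((z + c0) * (w + c0))))%C
    by (unfold T; field; split; assumption).
  set (dz := Cmod (z - w)).
  assert (Hdz : 0 <= dz) by apply Cmod_ge_0.
  rewrite Cmod_mult, Cmod_R, Rabs_pos_eq by nra.
  assert (B1 : Cmod ((Khat d gam z - Khat d gam w) / (z + c0)) <=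
               8 * D / a ^ 2 * dz * / a).
  { rewrite Cmod_div by assumption; apply Rmult_le_compat.
    - apply Cmod_ge_0.
    - left; apply Rinv_0_lt_compat; specialize (Hc z Hz); lra.
    - apply Rle_trans with
        (1 := Khat_lipschitz d gam z w (a / 2) Hd Ha2 (Hm z Hz) (Hm w Hw)).
      right; unfold dz, D; field; lra.
    - apply Rinv_le_contravar; [lra | now apply Hc]. }
  assert (B2 : Cmod (Khat d gam w * (- (z - w)) / ((z + c0) * (w + c0))) <=
               4 * D / a * dz * / (a * a)).
  { rewrite Cmod_div by now apply Cmult_neq_0.
    rewrite !Cmod_mult, Cmod_opp; apply Rmult_le_compat.
    - apply Rmult_le_pos; apply Cmod_ge_0.
    - left; apply Rinv_0_lt_compat; generalize (Hc z Hz) (Hc w Hw); nra.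
    - apply Rmult_le_compat_r; [exact Hdz | now apply HK].
    - apply Rinv_le_contravar; [nra|].
      apply Rmult_le_compat; [lra | lra | now apply Hc | now apply Hc]. }
  apply Rle_trans with (a ^ 2 * (8 * D / a ^ 2 * dz * / a + 4 * D / a * dz * / (a * a))).
  - apply Rmult_le_compat_l; [nra|].
    apply Rle_trans with (1 := Cmod_triangle _ _); lra.
  - replace (a ^ 2 * (8 * D / a ^ 2 * dz * / a + 4 * D / a * dz * / (a * a)))
      with (12 * D * dz * / a) by (field; lra).
    assert (/ a <= / 2) by (apply Rinv_le_contravar; lra).
    assert (0 < / a) by (apply Rinv_0_lt_compat; lra).
    assert (0 <= 12 * D * dz <= dz) by nra.
    nra. }
destruct (contraction_fixed_point T c0 1) as [z [Hz Ez]]; [lra | | exact HL |].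
{ intros z Hz; specialize (HT z Hz); lra. }
exists z; split; [|split].
- rewrite <- Ez; now apply HT.
- specialize (HI z Hz); lra.
- (* The fixed point equation, multiplied by [z + i a]. *)
  assert (E : (z * (z + c0) = c0 * (z + c0) + RtoC (a ^ 2) * Khat d gam z)%C).
  { rewrite <- Ez at 1; unfold T; field; now apply Hc0. }
  assert (Ec : (c0 * c0 = - RtoC (a ^ 2))%C).
  { unfold c0; apply injective_projections; simpl; ring. }
  replace (z ^ 2 + RtoC (a ^ 2) * (1 - Khat d gam z))%C with
    (z * (z + c0) - (c0 * (z + c0) + RtoC (a ^ 2) * Khat d gam z)
     + (c0 * c0 + RtoC (a ^ 2)))%C by ring.
  rewrite E, Ec; ring.
Qed.

(** * Asymptotics *)

Lemma Rpower_to_infinity (a : nat -> R) (s : R) :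
  0 < s -> is_lim_seq a p_infty -> is_lim_seq (fun n => Rpower (a n) s) p_infty.
Proof.
intros Hs Ha; apply is_lim_seq_spec; intros M.
apply is_lim_seq_spec in Ha.
destruct (Ha (Rpower (Rabs M + 1) (/ s))) as [N HN].
exists N; intros n Hn; specialize (HN n Hn).
assert (H0 : 0 < Rabs M + 1) by (generalize (Rabs_pos M); lra).
apply Rlt_le_trans with (Rabs M + 1); [generalize (Rle_abs M); lra|].
replace (Rabs M + 1) with (Rpower (Rpower (Rabs M + 1) (/ s)) s)
  by (rewrite Rpower_mult, Rinv_l, Rpower_1; lra).
apply Rle_Rpower_l; [lra|].
split; [apply exp_pos | lra].
Qed.

(** When the main term is no larger than the error allowed for [z - i a], the whole
    deviation fits in the complex remainder and the bracket is exactly [a]; the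
    scale [e2] is then arbitrary. *)
Lemma bigO_pair_asymptotics (a q main e2 : nat -> R) (z : nat -> C) (B : R) :
  0 <= B -> (forall n, 0 < q n) ->
  eventually (fun n => Cmod (z n - Ci * RtoC (a n)) <= B * q n) ->
  (forall n, Rabs (main n) <= B * q n) ->
  pair_asymptotics a z (fun n => Cconj (z n)) main q e2.
Proof.
intros HB Hq [N HN] Hmain.
set (E := fun n => (z n - Ci * RtoC (a n) - RtoC (main n))%C).
assert (HE : bigO (fun n => Cmod (E n)) q).
{ exists (2 * B), N; intros n Hn.
  rewrite !Rabs_pos_eq by (try apply Cmod_ge_0; left; apply Hq).
  apply Rle_trans with (1 := Cmod_triangle _ _).
  rewrite Cmod_opp, Cmod_R; specialize (HN n Hn); specialize (Hmain n); lra. }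
exists E, (fun n => Cconj (E n)), (fun _ => 0); split; [exact HE|split; [|split]].
- destruct HE as [M [N' H]]; exists M, N'; intros n Hn; rewrite Cmod_conj; now apply H.
- exists 0, 0%nat; intros n _; rewrite Rabs_R0; lra.
- intros n; unfold E; split; [rewrite Rplus_0_r; ring|].
  apply injective_projections; simpl; ring.
Qed.

(** * The zeros of [ell] and [f_fun] *)

Theorem theorem2p2 :
  forall (xi : R) (a c gam : nat -> R),
    0 < xi < 1 ->
    0 < a 0%nat ->
    (forall n : nat, a n < a (S n)) ->
    is_lim_seq a p_infty ->
    (forall k : nat, 0 < c k) ->
    0 < gam 0%nat ->
    (forall k : nat, gam k < gam (S k)) ->
    is_lim_seq gam p_infty ->
    ex_series (fun k => c k / gam k) ->
    Series (fun k => c k / gam k) < 1 ->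
    ex_series c ->
    Sup_seq (fun k => Finite (gam k * (gam (S k) - gam k))) = p_infty ->
    exists (mu x : nat -> nat -> R) (mup mum : nat -> C),
      (* for n large: the zeros of ell_n are the real zeros mu_{n,k} and one
         pair of non-real conjugate zeros *)
      eventually (fun n =>
        (forall z : C,
           mero_zero gam (ell xi a c gam n) z <->
           ((exists k : nat, z = RtoC (mu n k)) \/ z = mup n \/ z = mum n)) /\
        mup n = Cconj (mum n) /\
        0 < Im (mup n)) /\
      (* (1); the condition on a_n says f_n(0) > 0, it holds whenever a_n >= 1 *)
      (forall n : nat,
         Series (fun k => c k / gam k) < Rpower (a n) (2 * (1 - xi)) ->
         (forall t : R,
            mero_zero gam (f_fun xi a c gam n) (RtoC t) <->
            (exists k : nat, t = x n k)) /\
         (forall k : nat,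
            mero_zero gam (ell xi a c gam n) (RtoC (mu n k)) /\
            - gam k < mu n k /\ mu n k < x n k /\ x n k < - gam_prev gam k)) /\
      (exists M : R, eventually (fun n =>
         forall k : nat,
           Rabs (mu n k - x n k) <= M * / Rpower (a n) (2 * (1 - xi)))) /\
      (forall k : nat,
         is_lim_seq (fun n => mu n k) (Finite (- gam k)) /\
         is_lim_seq (fun n => x n k) (Finite (- gam k))) /\
      (* (2) *)
      (0 < xi < 1 / 2 ->
         pair_asymptotics a mup mum
           (fun n => - (1 / 2) * / Rpower (a n) (2 * (1 - xi)) * Series c)
           (fun n => / Rpower (a n) (2 * (1 - xi)))
           (fun n => / Rpower (a n) (1 - 2 * xi))) /\
      (1 / 2 < xi < 1 ->
         pair_asymptotics a mup mum
           (fun n => - (1 / 2) * / Rpower (a n) (2 * (1 - xi)) * Series c)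
           (fun n => / Rpower (a n) (2 * (1 - xi)))
           (fun n => Rpower (a n) (1 - 2 * xi))) /\
      (xi = 1 / 2 ->
         pair_asymptotics a mup mum
           (fun n => - (1 / 2) * / a n * Series c)
           (fun n => / a n)
           (fun _ => 1)).
Proof.
intros xi a c gam Hxi Ha0 Hai Hal Hc Hg0 Hgi Hgl _ _ Hcs _.
assert (Hg : pole_seq gam) by (repeat split; assumption).
assert (Hw : weights c) by (split; assumption).
set (P := fun n => Rpower (a n) (2 * (1 - xi))).
set (q := fun n => / P n).
assert (HP : forall n, 0 < P n) by (intros n; apply exp_pos).
assert (Hq : forall n, 0 < q n) by (intros n; apply Rinv_0_lt_compat, HP).
assert (HPl : is_lim_seq P p_infty) by (apply Rpower_to_infinity; [lra | exact Hal]).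
assert (Ha : forall n, 0 < a n).
{ induction n as [|n IH]; [exact Ha0 | specialize (Hai n); lra]. }
assert (Ha2 : forall n, 0 < a n ^ 2) by (intros n; apply pow_lt, Ha).
set (S0 := Series c).
assert (HS0 : 0 < S0) by (apply Series_gt_0; assumption).
set (d := fun n k => q n * c k).
assert (Hd : forall n, weights (d n)) by (intros n; now apply weights_scal).
assert (Sd : forall n, Series (d n) = q n * S0) by (intros n; apply Series_scal_l).
assert (Hdg : forall n, Series (fun k => c k / gam k) < P n ->
          Series (fun k => d n k / gam k) < 1).
{ intros n Hn.
  rewrite (Series_ext _ (fun k => q n * (c k / gam k)))
    by (intros k; unfold d, Rdiv; ring).
  rewrite Series_scal_l, <- (Rinv_l (P n)) by (apply Rgt_not_eq, HP).
  apply Rmult_lt_compat_l; [apply Hq | exact Hn]. }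
assert (Hf : forall n z, off_poles gam z -> f_fun xi a c gam n z = (1 - Khat (d n) gam z)%C).
{ intros n z Hz; unfold f_fun, d; now rewrite Khat_scal. }
assert (Hl : forall n z, off_poles gam z ->
   ell xi a c gam n z = (z ^ 2 + RtoC (a n ^ 2) * (1 - Khat (d n) gam z))%C).
{ intros n z Hz; unfold ell, d; now rewrite Khat_scal. }
(* For small [n] the choice is vacuous and the values are arbitrary. *)
destruct (functional_choice (fun (nk : nat * nat) (p : R * R) =>
  let (n, k) := nk in let (mu, x) := p in
  Series (fun k => c k / gam k) < P n ->
  - gam k < mu < x /\ x < - gam_prev gam k /\ Kreal (d n) gam x = 1 /\
  mu ^ 2 + a n ^ 2 * (1 - Kreal (d n) gam mu) = 0)) as [mx Hmx].
{ intros [n k].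
  destruct (Rlt_le_dec (Series (fun k => c k / gam k)) (P n)) as [H|H].
  2: { exists (0, 0); intros; lra. }
  destruct (Kreal_one_in_gap (d n) gam k Hg (Hd n) (Hdg n H)) as [x [Hx Kx]].
  destruct (quadratic_zero_left (a n ^ 2) (d n) gam k x Hg (Hd n) (Ha2 n) Hx Kx)
    as [mu [Hmu Kmu]].
  exists (mu, x); intros _; tauto. }
set (mu := fun n k => fst (mx (n, k))).
set (x := fun n k => snd (mx (n, k))).
assert (Hmu : forall n, Series (fun k => c k / gam k) < P n -> forall k,
  - gam k < mu n k < x n k /\ x n k < - gam_prev gam k /\ Kreal (d n) gam (x n k) = 1 /\
  mu n k ^ 2 + a n ^ 2 * (1 - Kreal (d n) gam (mu n k)) = 0).
{ intros n Hn k; specialize (Hmx (n, k)); unfold mu, x.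
  destruct (mx (n, k)) as [m y]; exact (Hmx Hn). }
clearbody mu x; clear mx Hmx.
assert (Hdist : forall n, Series (fun k => c k / gam k) < P n -> forall k,
  x n k + gam k <= S0 * q n).
{ intros n Hn k; destruct (Hmu n Hn k) as [[M1 M2] [M3 [M4 _]]].
  assert (Bx : between_poles gam k (x n k)) by (apply gap_between_poles; [exact Hg | lra | lra]).
  generalize (Kreal_le_dist (d n) gam k _ Hg (Hd n) Bx); rewrite M4, Sd; intros H.
  assert (Hpos : 0 < x n k + gam k) by lra.
  apply (Rmult_le_compat_r (x n k + gam k)) in H; [|lra].
  replace (q n * S0 / (x n k + gam k) * (x n k + gam k)) with (S0 * q n) in H
    by (field; lra).
  lra. }
destruct (functional_choice (fun (n : nat) (z : C) =>
  2 <= a n -> 12 * S0 <= P n ->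
  Cmod (z - Ci * RtoC (a n)) <= 4 * S0 * q n /\ 0 < Im z /\
  (z ^ 2 + RtoC (a n ^ 2) * (1 - Khat (d n) gam z))%C = RtoC 0)) as [z Hz].
{ intros n.
  destruct (Rle_lt_dec 2 (a n)) as [H1|H1]; [|exists (RtoC 0); intros; lra].
  destruct (Rle_lt_dec (12 * S0) (P n)) as [H2|H2]; [|exists (RtoC 0); intros; lra].
  destruct (quadratic_nonreal_zero (a n) (d n) gam Hg (Hd n) H1) as [z [Z1 Z2]].
  - rewrite Sd; unfold q.
    apply Rmult_le_reg_r with (P n); [apply HP|].
    replace (12 * (/ P n * S0) * P n) with (12 * S0)
      by (field; apply Rgt_not_eq, HP); lra.
  - exists z; intros _ _; split; [|exact Z2].
    rewrite Sd in Z1; lra. }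
assert (Hcond : eventually (fun n => Series (fun k => c k / gam k) < P n)).
{ apply is_lim_seq_spec in HPl; apply HPl. }
assert (Hlarge : eventually (fun n => 2 <= a n /\ 12 * S0 <= P n)).
{ apply is_lim_seq_spec in HPl; apply is_lim_seq_spec in Hal.
  apply filter_and; [generalize (Hal 2) | generalize (HPl (12 * S0))];
    apply filter_imp; intros n Hn; lra. }
assert (Hclose : eventually (fun n => Cmod (z n - Ci * RtoC (a n)) <= 4 * S0 * q n)).
{ revert Hlarge; apply filter_imp; intros n [H1 H2]; now apply Hz. }
assert (Hpair : forall e2,
  pair_asymptotics a z (fun n => Cconj (z n)) (fun n => - (1 / 2) * q n * S0) q e2).
{ intros e2; apply (bigO_pair_asymptotics _ _ _ _ _ (4 * S0)); [lra | exact Hq | exact Hclose |].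
  intros n; specialize (Hq n).
  replace (- (1 / 2) * q n * S0) with (- (/ 2 * (q n * S0))) by field.
  rewrite Rabs_Ropp, Rabs_pos_eq; nra. }
exists mu, x, z, (fun n => Cconj (z n)); split; [|split; [|split; [|split; [|split; [|split]]]]].
- generalize (filter_and _ _ Hcond Hlarge); apply filter_imp; intros n [Hn [H1 H2]].
  destruct (Hz n H1 H2) as [_ [Iz Ez]].
  split; [|split; [now rewrite Cconj_conj | exact Iz]].
  intros w; rewrite <- (quadratic_zeros (a n ^ 2) (d n) gam (mu n) (z n) w Hg (Hd n) (Ha2 n));
    [| lra | exact Ez |].
  + split; intros [O E]; split; try exact O; [rewrite <- Hl | rewrite Hl]; assumption.
  + intros k; destruct (Hmu n Hn k) as [M1 [M2 [_ M4]]]; split; [lra | exact M4].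
- intros n Hn; split.
  + intros t; transitivity (mero_zero gam (fun w => 1 - Khat (d n) gam w)%C (RtoC t)).
    * split; intros [O E]; split; try exact O; [rewrite <- Hf | rewrite Hf]; assumption.
    * rewrite (one_minus_Khat_zeros (d n) gam (x n) _ Hg (Hd n)).
      2: { intros k; destruct (Hmu n Hn k) as [M1 [M2 [M3 _]]]; split; [lra | exact M3]. }
      split; intros [k Ek]; exists k; [now apply RtoC_inj | now rewrite Ek].
  + intros k; destruct (Hmu n Hn k) as [[M1 M2] [M3 [_ M5]]].
    split; [|tauto].
    assert (O : off_poles_real gam (mu n k)).
    { apply (between_poles_off _ k), gap_between_poles; [exact Hg | lra | lra]. }
    assert (O' := proj2 (off_poles_RtoC _ _) O).
    split; [exact O'|].
    rewrite Hl, (proj2 (Kreal_correct _ _ _ Hg (Hd n) O)) by exact O'.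
    now rewrite <- RtoC_pow, <- RtoC_minus, <- RtoC_mult, <- RtoC_plus, M5.
- exists S0; revert Hcond; apply filter_imp; intros n Hn k.
  destruct (Hmu n Hn k) as [M1 _]; specialize (Hdist n Hn k).
  change (/ Rpower (a n) (2 * (1 - xi))) with (q n).
  rewrite Rabs_minus_sym, Rabs_pos_eq; lra.
- intros k.
  assert (Hq0 : is_lim_seq (fun n => - gam k + S0 * q n) (- gam k)).
  { replace (Finite (- gam k)) with (Rbar_plus (- gam k) (Rbar_mult S0 0))
      by (simpl; f_equal; ring).
    apply is_lim_seq_plus'; [apply is_lim_seq_const|].
    exact (is_lim_seq_scal_l q S0 0 (is_lim_seq_inv P p_infty HPl ltac:(discriminate))). }
  split; (apply is_lim_seq_le_le_loc with (2 := is_lim_seq_const (- gam k)) (3 := Hq0);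
    revert Hcond; apply filter_imp; intros n Hn;
    destruct (Hmu n Hn k) as [M1 _]; specialize (Hdist n Hn k); lra).
- intros _; apply Hpair.
- intros _; apply Hpair.
- intros E.
  assert (Eq : forall n, / a n = q n).
  { intros n; unfold q, P; rewrite E.
    replace (2 * (1 - 1 / 2)) with 1 by field; now rewrite Rpower_1. }
  destruct (Hpair (fun _ => 1)) as [Ep [Em [F [[M1 [N1 B1]] [[M2 [N2 B2]] [B3 HE]]]]]].
  exists Ep, Em, F; split; [|split; [|split; [exact B3|]]].
  + exists M1, N1; intros n Hn; rewrite Eq; now apply B1.
  + exists M2, N2; intros n Hn; rewrite Eq; now apply B2.
  + intros n; rewrite Eq; apply HE.
Qed.
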